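(* Let $p,q\in\mathbb{C}^*$ with $p\neq q$, and let $A$ be a unital associative $\mathbb{C}$-algebra containing elements $a,a^{+}$, with $a^{+}$ invertible, such that $$p\,a\,a^{+}-q\,a^{+}a=1 .$$ For $n\in\mathbb{Z}$ put $L_n=(a^{+})^{n+1}a\in A$. Define $$[L_n,L_m]:=p^{-n}q^{n}L_nL_m-p^{-m}q^{m}L_mL_n .$$ Then for all $m,n\in\mathbb{Z}$ $$[L_n,L_m]=\Big(\frac{[m]_{p,q}}{p^{m}}-\frac{[n]_{p,q}}{p^{n}}\Big)L_{m+n}=\big(q^{n}[m]_{p,q}-q^{m}[n]_{p,q}\big)p^{-(m+n)}L_{m+n}.$$
   Context: For $n\in\mathbb{Z}$, $[n]_{p,q}=\dfrac{p^{n}-q^{n}}{p-q}$. *)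

(* Defs.v *)
From mathcomp Require Import all_boot all_order all_algebra.
From mathcomp Require Export complex.
From mathcomp Require Export reals.

Set Implicit Arguments.
Unset Strict Implicit.
Unset Printing Implicit Defensive.

Import GRing.Theory.
Local Open Scope ring_scope.

(* In this file and in the theorem, [x ^ n] with [n : int] is [exprz]; for
   [n < 0] it is the power of the inverse only when [x] is a unit. *)

Definition pqint (F : fieldType) (p q : F) (n : int) : F :=
  (p ^ n - q ^ n) / (p - q).

Definition pqL (F : fieldType) (A : unitAlgType F) (a ap : A) (n : int) : A :=
  ap ^ (n + 1) * a.

(* The bracket is a function of the indices, not of the elements [L_n] and
   [L_m]: its coefficients depend on [n] and [m]. *)
Definition pqbracket (F : fieldType) (A : unitAlgType F) (p q : F) (a ap : A)
    (n m : int) : A :=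
  (p ^ (- n) * q ^ n) *: (pqL a ap n * pqL a ap m)
  - (p ^ (- m) * q ^ m) *: (pqL a ap m * pqL a ap n).

(* Main.v *)
Require Import Defs.
From mathcomp Require Import all_boot all_order all_algebra.
From mathcomp Require Import complex reals.
From mathcomp Require Import ring.

Import GRing.Theory.

Local Open Scope ring_scope.
Local Open Scope complex_scope.

(** Put [x = q / p] and [s = 1 / (p - q)].  The inhomogeneous relation
    [p a a+ - q a+ a = 1] becomes homogeneous after a shift of [a]: the element
    [u = a - s (a+)^-1] satisfies [u a+ = x a+ u], and such a relation passes to
    all integer powers of [a+] ([scaled_commutation_exprz]).  Undoing the shift
    gives
      [a (a+)^k = x^k (a+)^k a + s (1 - x^k) (a+)^(k-1)]
    for every integer [k], where [s (1 - x^k) = [k]_{p,q} / p^k].  Hence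
      [L_n L_m = x^(m+1) (a+)^(m+n+2) a a + s (1 - x^(m+1)) L_(m+n)]
    ([pqL_mul]).  The bracket weights this product by [x^n] and the opposite
    one by [x^m], so that the quadratic term gets the coefficient [x^(m+n+1)]
    both times and cancels, while [L_(m+n)] is left with [s (x^n - x^m)].  Both
    coefficients in the theorem are forms of this one. *)

Lemma scaled_commutation_exprn {F : fieldType} {A : unitAlgType F} (x : F)
    (u b : A) (k : nat) :
  u * b = x *: (b * u) -> u * b ^+ k = x ^+ k *: (b ^+ k * u).
Proof.
move=> ub; elim: k => [|k IHk]; first by rewrite !expr0 mulr1 mul1r scale1r.
by rewrite !exprS mulrA ub -scalerAl -(mulrA b u) IHk -scalerAr mulrA scalerA.
Qed.

(** Multiplying the relation by [b^-1] on both sides turns it into the same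
    relation for [b^-1] and [x^-1], so negative powers reduce to natural ones. *)
Lemma scaled_commutation_exprz {F : fieldType} {A : unitAlgType F} (x : F)
    (u b : A) (k : int) :
  x != 0 -> b \is a GRing.unit ->
  u * b = x *: (b * u) -> u * b ^ k = x ^ k *: (b ^ k * u).
Proof.
move=> x0 bU ub; case: k => k; first exact: scaled_commutation_exprn.
rewrite NegzE -!exprnN -!exprVn; apply: scaled_commutation_exprn.
apply: (mulrI bU); apply: (mulIr bU).
rewrite -scalerAr -scalerAl mulVKr // -(mulrA b) mulrVK //.
by rewrite ub scalerA mulVf // scale1r.
Qed.

(** The element [a - (p - q)^-1 ap^-1] commutes with [ap] up to the factor
    [q / p]; the second summand below is what [(p - q)^-1 ap^-1] contributes
    when [ap ^ k] is moved to its left. *)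
Lemma mul_annihilator_exprz {F : fieldType} {A : unitAlgType F} (p q : F)
    (a ap : A) (k : int) :
  p != 0 -> q != 0 -> p != q -> ap \is a GRing.unit ->
  p *: (a * ap) - q *: (ap * a) = 1 ->
  a * ap ^ k = (q / p) ^ k *: (ap ^ k * a)
               + ((1 - (q / p) ^ k) / (p - q)) *: ap ^ (k - 1).
Proof.
move=> p0 q0 pq apU rel; have pq0 : p - q != 0 by rewrite subr_eq0.
have aap : a * ap = (q / p) *: (ap * a) + p^-1 *: 1.
  rewrite -rel scalerBr !scalerA mulVf // scale1r mulrC.
  by rewrite addrC subrK.
(* With [x = q / p], subtracting [c ap^-1] from [a] removes [c] from [a ap]
   and [x c] from [x ap a], so it absorbs the constant [p^-1] exactly when
   [c (1 - x) = p^-1], that is [c = (p - q)^-1]. *)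
pose u := a - (p - q)^-1 *: ap^-1.
have uap : u * ap = (q / p) *: (ap * u).
  rewrite mulrBl mulrBr -scalerAl -scalerAr mulVr // mulrV // aap scalerBr.
  rewrite -addrA -scalerBl scalerA -scaleNr; congr (_ + _ *: _).
  by field; rewrite pq0.
have x0 : q / p != 0 by rewrite mulf_neq0 ?invr_eq0.
have := scaled_commutation_exprz _ _ _ k x0 apU uap.
rewrite mulrBl mulrBr -scalerAl -scalerAr -[ap^-1]/(ap ^ (-1)).
rewrite -!exprzDr // [-1 + k]addrC => /eqP; rewrite subr_eq => /eqP ->.
rewrite scalerBr scalerA -addrA -scaleNr -scalerDl.
by congr (_ + _ *: _); rewrite mulrBl mul1r addrC.
Qed.

Lemma pqL_mul {F : fieldType} {A : unitAlgType F} (p q : F) (a ap : A)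
    (n m : int) :
  p != 0 -> q != 0 -> p != q -> ap \is a GRing.unit ->
  p *: (a * ap) - q *: (ap * a) = 1 ->
  pqL a ap n * pqL a ap m
  = (q / p) ^ (m + 1) *: (ap ^ (m + n + 2) * a * a)
    + ((1 - (q / p) ^ (m + 1)) / (p - q)) *: pqL a ap (m + n).
Proof.
move=> p0 q0 pq apU rel; rewrite /pqL mulrA -(mulrA _ a).
rewrite (mul_annihilator_exprz p q) // addrK mulrDr mulrDl.
rewrite -!scalerAr -!scalerAl mulrA -!exprzDr //.
by congr (_ *: (ap ^ _ * a * a) + _ *: (ap ^ _ * a)); ring.
Qed.

Lemma pqint_div {F : fieldType} (p q : F) (n : int) :
  p != 0 -> pqint p q n / p ^ n = (1 - (q / p) ^ n) / (p - q).
Proof.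
move=> p0; rewrite /pqint mulrAC mulrBl divff ?expfz_neq0 //.
by rewrite expfzMl exprz_inv invr_expz.
Qed.

Theorem lemma2p2 (R : realType) (p q : R[i]) (A : unitAlgType R[i]) (a ap : A)
    (hp : p != 0) (hq : q != 0) (hpq : p != q)
    (hap : ap \is a GRing.unit)
    (hrel : p *: (a * ap) - q *: (ap * a) = 1)
    (m n : int) :
  pqbracket p q a ap n m
    = (pqint p q m / p ^ m - pqint p q n / p ^ n) *: pqL a ap (m + n)
  /\
  (pqint p q m / p ^ m - pqint p q n / p ^ n) *: pqL a ap (m + n)
    = ((q ^ n * pqint p q m - q ^ m * pqint p q n) * p ^ (- (m + n)))
        *: pqL a ap (m + n).
Proof.
have x0 : q / p != 0 by rewrite mulf_neq0 ?invr_eq0.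
have hd : p - q != 0 by rewrite subr_eq0.
have weight k : p ^ (- k) * q ^ k = (q / p) ^ k.
  by rewrite expfzMl exprz_inv mulrC.
split.
- (* Both quadratic terms carry the exponent [m + n + 1] of [q / p]. *)
  rewrite /pqbracket !weight !(pqL_mul p q) // (addrC n m).
  rewrite !scalerDr !scalerA opprD addrACA -!scalerBl !pqint_div //.
  rewrite -!expfzDr // (_ : n + (m + 1) = m + (n + 1)); last by ring.
  rewrite subrr scale0r add0r; congr (_ *: _).
  by rewrite !expfzDr // expr1z; field; rewrite hd.
- congr (_ *: _); rewrite /pqint -invr_expz expfzDr //.
  by field; rewrite hd !expfz_neq0.
Qed.
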